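(* Let $C$ be a finite set of $m \ge 8$ candidates, let the committee size be $k = 8$, and let $P$ be a profile over $C$. Then there exists a global PAV committee $W \subseteq C$ with $|W| = 8$ for the profile $P$ that is core stable, i.e., some global PAV committee is in the core.
   Context: Let $\mathcal{A}$ be the set of non-empty subsets of $C$; its elements are called ballots. A profile is a map $P : \mathcal{A} \to \mathbb{Q}_{\ge 0}$ with $\sum_{A \in \mathcal{A}} P(A) = 1$. A committee is a subset $W \subseteq C$ with $|W| = k$. For a ballot $A$ and a set $X \subseteq C$, let $u_A(X) = |A \cap X|$. A potential deviation is a non-empty set $T \subseteq C$ with $|T| \le k$. It is a (successful) deviation from the committee $W$ (under $P$) if $\sum_{A \in \mathcal{A} : u_A(T) > u_A(W)} P(A) \ge \frac{|T|}{k}$. A committee $W$ is core stable if no potential deviation is a deviation from $W$, i.e. $\sum_{A \in \mathcal{A} : u_A(T) > u_A(W)} P(A) < \frac{|T|}{k}$ for every potential deviation $T$. The core (of $P$, for size $k$) is the set of core-stable committees. Let $H(n) = 1 + \frac12 + \cdots + \frac1n$ (with $H(0)=0$). The PAV score of a set $X \subseteq C$ is $\mathrm{PAV}_P(X) = \sum_{A \in \mathcal{A}} P(A) \cdot H(u_A(X))$. A committee $W$ is a global PAV committee if $\mathrm{PAV}_P(W) \ge \mathrm{PAV}_P(W')$ for every committee $W'$. *)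

(* Defs.v *)
From HB Require Import structures.
From mathcomp Require Import all_boot all_order all_algebra.

Set Implicit Arguments.
Unset Strict Implicit.
Unset Printing Implicit Defensive.

Import Order.TTheory GRing.Theory Num.Theory.
Local Open Scope ring_scope.

Notation ballot C := {A : {set C} | A != set0}.

Definition is_profile (C : finType) (P : ballot C -> rat) : Prop :=
  (forall A, 0 <= P A) /\ \sum_A P A = 1.

Definition is_committee (C : finType) (k : nat) (W : {set C}) : bool :=
  #|W| == k.

Definition utility (C : finType) (A : ballot C) (X : {set C}) : nat :=
  #|val A :&: X|.

Definition potential_deviation (C : finType) (k : nat) (T : {set C}) : bool :=
  (T != set0) && (#|T| <= k)%N.

Definition deviation (C : finType) (k : nat) (P : ballot C -> rat)
    (W T : {set C}) : bool :=
  potential_deviation k T &&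
  (#|T|%:R / k%:R <= \sum_(A | (utility A W < utility A T)%N) P A).

Definition core_stable (C : finType) (k : nat) (P : ballot C -> rat)
    (W : {set C}) : bool :=
  is_committee k W && [forall T, ~~ deviation k P W T].

Definition core (C : finType) (k : nat) (P : ballot C -> rat) :
    {set {set C}} :=
  [set W | core_stable k P W].

Definition harmonic (n : nat) : rat := \sum_(1 <= i < n.+1) i%:R^-1.

Definition pav_score (C : finType) (P : ballot C -> rat) (X : {set C}) : rat :=
  \sum_A P A * harmonic (utility A X).

Definition global_pav_committee (C : finType) (k : nat) (P : ballot C -> rat)
    (W : {set C}) : Prop :=
  is_committee k W /\
  forall W' : {set C}, is_committee k W' -> pav_score P W' <= pav_score P W.

(* Main.v *)
(** Swapping [x] of a global PAV committee [W] for [y] outside [W] never increases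
    the score.  If [T] deviates from [W], add up these inequalities over all [x] in
    [W :\: T] and [y] in [T :\: W]: a ballot with a, b, c candidates in [W :\: T],
    [W :&: T], [T :\: W] gains (|W\T| - a) c / (a + b + 1) - a (|T\W| - c) / (a + b),
    which is at least |T\W| (8 [a < c] / |T| - 1), strictly if [a < c], except when
    |T| = 4, |W :&: T| = 2 and (a, b, c) = (0, 2, 1).  So only that case can occur,
    with equality everywhere: half of the mass approves [W :&: T], one more
    candidate of [T] and nothing of [W :\: T], the other half approves nothing of
    [T], and every swap is neutral.

    Then [W' = W - x + y], for [y] in a deviating ballot [A], is again a global PAV
    committee.  If some [T'] deviated from it, then [T'] would be disjoint from
    [A], since [A] has utility 3 in [W'].  Hence a candidate [z] of [W :&: T] is in
    [W' :\: T']; equality forces its removal loss to be 1/12, but the ballots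
    deviating from [W] to [T] all approve [z] with utility at most 3 in [W'], so
    they alone contribute 1/6. *)

Require Import Defs.
From mathcomp Require Import all_boot all_order all_algebra.
From mathcomp Require Import ring lra zify.

Section PAVSwaps.

Set Implicit Arguments.
Unset Strict Implicit.
Unset Printing Implicit Defensive.

Import Order.TTheory GRing.Theory Num.Theory.
Local Open Scope ring_scope.

(** * Score change under a single swap *)

Lemma harmonicS n : harmonic n.+1 = harmonic n + n.+1%:R^-1.
Proof. by rewrite /harmonic big_nat_recr. Qed.

(** Effect on [A] of swapping [x] in [W] for [y] outside. The second term never divides by zero: if
    [x] is approved, the utility of [W] is at least 1. *)
Definition ballot_gain (C : finType) (W : {set C}) (x y : C) (A : ballot C) : rat :=
  ((y \in val A) && (x \notin val A))%:R / (utility A W).+1%:R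
  - ((x \in val A) && (y \notin val A))%:R / (utility A W)%:R.

Section Swap.
Variables (C : finType) (W : {set C}) (x y : C).
Hypotheses (xW : x \in W) (yW : y \notin W).
Implicit Type A : ballot C.

Lemma card_swap : #|y |: W :\ x| = #|W|.
Proof.
by rewrite cardsU1 in_setD1 (negbTE yW) andbF [in RHS](cardsD1 x W) xW.
Qed.

Lemma utility_swap A :
  (utility A (y |: W :\ x) + (x \in val A) = utility A W + (y \in val A))%N.
Proof.
rewrite /utility (cardsD1 y) (cardsD1 x (val A :&: W)) !inE eqxx xW andbT /=.
rewrite -!setIDA setU1K; last by rewrite in_setD1 (negbTE yW) andbF.
by rewrite addnC andbT addnA addnAC.
Qed.

Lemma harmonic_utility_swap A :
  harmonic (utility A (y |: W :\ x)) - harmonic (utility A W)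
  = ballot_gain W x y A.
Proof.
rewrite /ballot_gain; have := utility_swap A.
case: (x \in _); case: (y \in _) => /= e.
- have -> : utility A (y |: W :\ x) = utility A W by lia.
  by rewrite !mul0r !subrr.
- have -> : utility A W = (utility A (y |: W :\ x)).+1 by lia.
  by rewrite harmonicS !mul0r mul1r; ring.
- have -> : utility A (y |: W :\ x) = (utility A W).+1 by lia.
  by rewrite harmonicS !mul0r mul1r; ring.
- have -> : utility A (y |: W :\ x) = utility A W by lia.
  by rewrite !mul0r !subrr.
Qed.

Lemma pav_score_swap (P : ballot C -> rat) :
  pav_score P (y |: W :\ x) - pav_score P W = \sum_A P A * ballot_gain W x y A.
Proof.
rewrite /pav_score -sumrB; apply: eq_bigr => A _.
by rewrite -mulrBr harmonic_utility_swap.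
Qed.

End Swap.

(** * Counting sums and the numerical ballot inequality *)

Lemma sum_mem_rat (C : finType) (X A : {set C}) :
  \sum_(x in X) (x \in A)%:R = #|A :&: X|%:R :> rat.
Proof.
rewrite -natr_sum -sum1_card; congr _%:R.
rewrite -big_mkcondr; apply: eq_bigl => x.
by rewrite inE andbC.
Qed.

Lemma sum_notin_rat (C : finType) (X A : {set C}) :
  \sum_(x in X) (x \notin A)%:R = #|X|%:R - #|A :&: X|%:R :> rat.
Proof.
rewrite -sum_mem_rat -sum1_card natr_sum -sumrB; apply: eq_bigr => x _.
by case: (x \in A); rewrite ?subrr ?subr0.
Qed.

(** The equality cases of the ballot inequality, with [t = #|T|], [i = #|W :&: T|]. *)
Definition slack_spec (t i a b c : nat) : bool :=
  if (a < c)%N then [&& t == 4, i == 2, a == 0, b == 2 & c == 1]%N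
  else ((t == 4) && (i == 2) ==> (b == 0) && (c == 0))%N.

(** [0 <= slack t i a b c] with denominators cleared; [v] replaces [u] because
    [a / u] is [0] when [u = 0]. *)
Definition slack_check (t i a b c : nat) : bool :=
  let n := (t - i)%N in let u := (a + b)%N in let v := maxn u 1 in
  let lhs := (t * (8 - i - a) * c * v + t * n * v * u.+1)%N in
  let rhs := (t * a * (n - c) * u.+1 + 8 * n * (a < c) * v * u.+1)%N in
  (rhs <= lhs)%N && ((lhs == rhs) ==> slack_spec t i a b c).

(** Since [t] is at most 8, only finitely many tuples occur, and all are checked by computation. *)
Lemma slack_checkP (t i a b c : nat) :
  (i < t)%N -> (t <= 8)%N -> (a <= 8 - i)%N -> (b <= i)%N -> (c <= t - i)%N ->
  slack_check t i a b c.
Proof.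
move=> it t8 ai bi ct.
have : all (fun t => all (fun i => all (fun a => all (fun b =>
    all (slack_check t i a b) (iota 0 (t - i).+1))
    (iota 0 i.+1)) (iota 0 (8 - i).+1)) (iota 0 t)) (iota 0 9).
  by vm_compute.
have mem m j : (j < m)%N -> j \in iota 0 m by rewrite mem_iota.
move=> /allP/(_ t (mem 9 _ t8))/allP/(_ i (mem _ _ it)).
move=> /allP/(_ a (mem _.+1 _ ai))/allP/(_ b (mem _.+1 _ bi)).
by move=> /allP/(_ c (mem _.+1 _ ct)).
Qed.

(** [t] times the gain of a ballot summed over all swaps, plus [t * (t - i)], minus [8 * (t - i)] if
    the ballot prefers [T]. Its average over a profile thus combines the total swap gain with the
    deviating mass. *)
Definition slack (t i a b c : nat) : rat :=
  t%:R * (((8 - i)%:R - a%:R) * c%:R / (a + b).+1%:R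
          - a%:R * ((t - i)%:R - c%:R) / (a + b)%:R)
  + t%:R * (t - i)%:R - 8%:R * (t - i)%:R * (a < c)%N%:R.

Lemma slackP (t i a b c : nat) :
  (i < t)%N -> (t <= 8)%N -> (a <= 8 - i)%N -> (b <= i)%N -> (c <= t - i)%N ->
  0 <= slack t i a b c /\ (slack t i a b c = 0 -> slack_spec t i a b c).
Proof.
move=> it t8 ai bi ct; have := slack_checkP it t8 ai bi ct.
rewrite /slack_check.
set u := (a + b)%N; set v := maxn u 1.
set rhs := (_ + _)%N; set lhs := (_ + _)%N => /andP[le_rl eq_spec].
have v_gt0 : 0 < v%:R :> rat by rewrite ltr0n /v leq_max orbT.
(* If [u = 0], the quotient is 0 by convention, and so is [a]. *)
have aVu : a%:R * v%:R / u%:R = a%:R :> rat.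
  have [u0|u_gt0] := posnP u; first by rewrite (_ : a = 0)%N ?mul0r //; lia.
  by rewrite /v (maxn_idPl u_gt0) mulfK // pnatr_eq0 -lt0n.
have uS_neq0 : u.+1%:R != 0 :> rat by rewrite pnatr_eq0.
have slackE : slack t i a b c * (v%:R * u.+1%:R) = lhs%:R - rhs%:R.
  rewrite /slack -/u /lhs /rhs; clearbody v u; rewrite !natrD !natrM.
  rewrite (natrB _ ai) (natrB _ ct).
  (* The inverse of [u] becomes the atom [y], as [u] may be 0; only [x] is known to be
     invertible. *)
  set x := u.+1%:R in uS_neq0 *; set y := u%:R^-1 in aVu *.
  set m := (t - i)%:R; set d := (8 - i)%:R; set e := (_ < _)%:R.
  transitivity (t%:R * (d - a%:R) * c%:R * v%:R + t%:R * m * v%:R * x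
    - t%:R * (a%:R * v%:R * y) * (m - c%:R) * x - 8%:R * m * e * v%:R * x).
    by clearbody x y; field.
  by rewrite aVu; ring.
have den_gt0 : 0 < v%:R * u.+1%:R :> rat by rewrite mulr_gt0 // ltr0n.
split.
  by rewrite -(pmulr_lge0 _ den_gt0) slackE subr_ge0 ler_nat.
move=> slack0; move: slackE; rewrite slack0 mul0r => /esym/eqP.
by rewrite subr_eq0 eqr_nat => /(implyP eq_spec).
Qed.

(** * Total gain over the swaps between [W :\: T] and [T :\: W] *)

Section Deviation.
Variables (C : finType) (W T : {set C}).
Implicit Type A : ballot C.

Let a A := #|val A :&: (W :\: T)|.
Let b A := #|val A :&: (W :&: T)|.
Let c A := #|val A :&: (T :\: W)|.

Lemma utility_split A : utility A W = (a A + b A)%N.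
Proof.
by rewrite /utility /a /b setIDA setIA addnC cardsID.
Qed.

Lemma utility_split_dev A : utility A T = (b A + c A)%N.
Proof.
by rewrite /utility /b /c setIDA setIA setIAC cardsID.
Qed.

Lemma utility_dev A : (utility A W < utility A T)%N = (a A < c A)%N.
Proof. by rewrite utility_split utility_split_dev addnC ltn_add2l. Qed.

Lemma sum_ballot_gain_in x A :
  \sum_(y in T :\: W) ballot_gain W x y A
  = (x \notin val A)%:R * (c A)%:R / (utility A W).+1%:R
    - (x \in val A)%:R * (#|T :\: W|%:R - (c A)%:R) / (utility A W)%:R.
Proof.
rewrite sumrB -!mulr_suml -sum_notin_rat /c -(sum_mem_rat (T :\: W)) !mulr_sumr.
by congr (_ / _ - _ / _); apply: eq_bigr => y _; rewrite -mulnb natrM // mulrC.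
Qed.

Lemma sum_ballot_gain A :
  \sum_(x in W :\: T) \sum_(y in T :\: W) ballot_gain W x y A
  = (#|W :\: T|%:R - (a A)%:R) * (c A)%:R / (utility A W).+1%:R
    - (a A)%:R * (#|T :\: W|%:R - (c A)%:R) / (utility A W)%:R.
Proof.
under eq_bigr do rewrite sum_ballot_gain_in.
by rewrite sumrB -!mulr_suml sum_mem_rat sum_notin_rat.
Qed.

(** * Equalities forced by a deviation from a global PAV committee *)

Section Tight.
Variables (P : ballot C -> rat).
Hypotheses (hP : is_profile P) (hW : global_pav_committee 8 P W).
Hypothesis hT : deviation 8 P W T.

Lemma swap_le0 x y : x \in W -> y \notin W ->
  \sum_A P A * ballot_gain W x y A <= 0.
Proof.
move=> xW yW; rewrite -pav_score_swap // subr_le0.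
by apply: hW.2; rewrite /is_committee card_swap //; exact: hW.1.
Qed.

Let D := \sum_(A | (utility A W < utility A T)%N) P A.

Lemma dev_exists : exists2 A, (utility A W < utility A T)%N & P A != 0.
Proof.
have /andP[/andP[T0 _] leD] := hT.
have D_gt0 : 0 < D.
  by apply: lt_le_trans leD; rewrite divr_gt0 ?ltr0n // card_gt0.
have [A|A0] := pickP (fun A => (utility A W < utility A T)%N && (P A != 0)).
  by case/andP; exists A.
move: D_gt0; rewrite /D big1 ?ltxx // => A devA.
by apply/eqP; have := A0 A; rewrite devA => /negbFE.
Qed.

Lemma card_WT_lt : (#|W :&: T| < #|T|)%N.
Proof.
have [A devA _] := dev_exists.
rewrite -(cardsID W T) setIC -addn1 leq_add2l card_gt0.
apply: contraTneq devA => TW0.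
by rewrite utility_dev /c TW0 setI0 cards0 ltn0.
Qed.

Let s A := slack #|T| #|W :&: T| (a A) (b A) (c A).

Lemma ballot_slackP A :
  0 <= s A /\ (s A = 0 -> slack_spec #|T| #|W :&: T| (a A) (b A) (c A)).
Proof.
have /andP[/andP[_ T8] _] := hT; have /eqP W8 := hW.1.
apply: slackP => //; first exact: card_WT_lt.
- by rewrite -W8 -cardsD subset_leq_card // subsetIr.
- by rewrite subset_leq_card // subsetIr.
- by rewrite setIC -cardsD subset_leq_card // subsetIr.
Qed.

Let G A := \sum_(x in W :\: T) \sum_(y in T :\: W) ballot_gain W x y A.

Lemma slackE A : s A = #|T|%:R * G A + #|T|%:R * #|T :\: W|%:R
  - 8%:R * #|T :\: W|%:R * (utility A W < utility A T)%N%:R.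
Proof.
have /eqP W8 := hW.1.
by rewrite /s /slack /G sum_ballot_gain utility_dev utility_split -W8 -cardsD
  setIC -cardsD.
Qed.

Lemma sum_gainE : \sum_A P A * G A
  = \sum_(x in W :\: T) \sum_(y in T :\: W) \sum_A P A * ballot_gain W x y A.
Proof.
under eq_bigr do rewrite /G mulr_sumr.
rewrite exchange_big; apply: eq_bigr => x _.
under eq_bigr do rewrite mulr_sumr.
by rewrite exchange_big.
Qed.

Lemma sum_slackE : \sum_A P A * s A = #|T|%:R * (\sum_A P A * G A)
  + #|T :\: W|%:R * (#|T|%:R - 8%:R * D).
Proof.
have -> : #|T|%:R - 8%:R * D
    = \sum_A P A * (#|T|%:R - 8%:R * (utility A W < utility A T)%N%:R).
  under [RHS]eq_bigr do rewrite mulrBr mulrCA.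
  rewrite sumrB -mulr_suml hP.2 mul1r -mulr_sumr /D big_mkcond.
  by congr (_ - _ * _); apply: eq_bigr => A _; case: ifP; rewrite ?mulr1 ?mulr0.
rewrite !mulr_sumr -big_split /=.
by apply: eq_bigr => A _; rewrite slackE; ring.
Qed.

Lemma sum_gain_le0 : \sum_A P A * G A <= 0.
Proof.
rewrite sum_gainE; apply: sumr_le0 => x; rewrite inE => /andP[_ xW].
by apply: sumr_le0 => y; rewrite inE => /andP[yW _]; apply: swap_le0.
Qed.

(** In [sum_slackE] the left side is nonnegative by the ballot inequality. Both terms on the right
    are nonpositive, one by optimality of [W], the other by the size of the deviating mass. So
    everything vanishes, and the slack does so ballot by ballot. *)
Lemma slack_tight : [/\ \sum_A P A * G A = 0, #|T|%:R = 8%:R * D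
  & forall A, P A != 0 -> s A = 0].
Proof.
have /andP[/andP[T0 _]] := hT; rewrite -/D ler_pdivrMr ?ltr0n // => leD.
have T_gt0 : 0 < #|T|%:R :> rat by rewrite ltr0n card_gt0.
have TW_gt0 : 0 < #|T :\: W|%:R :> rat.
  by rewrite ltr0n cardsD subn_gt0 setIC card_WT_lt.
have Ps_ge0 A : 0 <= P A * s A by rewrite mulr_ge0 ?hP.1 // (ballot_slackP A).1.
have gain_le0 : #|T|%:R * (\sum_A P A * G A) <= 0.
  by rewrite pmulr_rle0 ?sum_gain_le0.
have dev_le0 : #|T :\: W|%:R * (#|T|%:R - 8%:R * D) <= 0.
  by rewrite pmulr_rle0 // subr_le0 mulrC.
have sum_ge0 : 0 <= \sum_A P A * s A by apply: sumr_ge0.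
have := sum_slackE => sumE.
split.
- by apply/eqP; rewrite -(mulrI_eq0 _ (lregP (lt0r_neq0 T_gt0))); lra.
- by apply/eqP; rewrite -subr_eq0 -(mulrI_eq0 _ (lregP (lt0r_neq0 TW_gt0))); lra.
have sum0 : \sum_A P A * s A = 0 by lra.
move=> A /negbTE PA0; apply/eqP.
have /eqP : P A * s A = 0 by apply: (psumr_eq0P (fun A _ => Ps_ge0 A) sum0).
by rewrite mulf_eq0 PA0.
Qed.

Lemma tight_card : #|T| = 4%N /\ #|W :&: T| = 2%N.
Proof.
have [_ _ s0] := slack_tight; have [A devA PA0] := dev_exists.
have := (ballot_slackP A).2 (s0 A PA0).
by rewrite /slack_spec -utility_dev devA => /and5P[/eqP -> /eqP ->].
Qed.

Lemma tight_mass : D = 2%:R^-1.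
Proof. by have [_ + _] := slack_tight; rewrite tight_card.1; lra. Qed.

Lemma tight_ballot A : P A != 0 ->
  if (utility A W < utility A T)%N then [&& a A == 0, b A == 2 & c A == 1]%N
  else (b A == 0)%N && (c A == 0)%N.
Proof.
have [_ _ s0] := slack_tight => /s0/(ballot_slackP A).2.
rewrite /slack_spec utility_dev; have [-> ->] := tight_card.
by case: ifP.
Qed.

(** Nonpositive terms with sum 0 all vanish; signs are flipped to apply [psumr_eq0P] to the outer
    and then the inner sum. *)
Lemma tight_swap x y : x \in W :\: T -> y \in T :\: W ->
  \sum_A P A * ballot_gain W x y A = 0.
Proof.
have [+ _ _] := slack_tight; rewrite sum_gainE => /eqP sum0 xWT yTW.
have le0 x' y' : x' \in W :\: T -> y' \in T :\: W ->
    0 <= - (\sum_A P A * ballot_gain W x' y' A).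
  by rewrite !inE oppr_ge0 => /andP[_ ?] /andP[? _]; apply: swap_le0.
have inner0 : - (\sum_(y in T :\: W) \sum_A P A * ballot_gain W x y A) = 0.
  apply: (psumr_eq0P (P := mem (W :\: T)) (F := fun x =>
    - (\sum_(y in T :\: W) \sum_A P A * ballot_gain W x y A))) => //.
    by move=> x' x'WT; rewrite -sumrN; apply: sumr_ge0 => y'; apply: le0.
  by rewrite sumrN (eqP sum0) oppr0.
apply/eqP; rewrite -oppr_eq0; apply/eqP.
apply: (psumr_eq0P (P := mem (T :\: W)) (F := fun y =>
    - (\sum_A P A * ballot_gain W x y A))) => //.
  by move=> y'; apply: le0.
by rewrite sumrN.
Qed.

(** Add the neutral swaps of [x] for the two candidates of [T :\: W]. Deviating ballots (mass 1/2,
    utility 2) gain 1/3 each, and the others lose twice the removal loss of [x], so 1/6 is twice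
    that loss. *)
Lemma tight_loss x : x \in W :\: T ->
  \sum_(A : ballot C | x \in val A) P A / (utility A W)%:R = 12%:R^-1.
Proof.
move=> xWT; apply: (mulfI (_ : 2%:R != 0)) => //.
have TW2 : #|T :\: W| = 2%N by rewrite cardsD setIC tight_card.1 tight_card.2.
have : \sum_A P A * \sum_(y in T :\: W) ballot_gain W x y A = 0.
  under eq_bigr do rewrite mulr_sumr.
  by rewrite exchange_big big1 // => y yTW; apply: tight_swap.
have -> : \sum_A P A * \sum_(y in T :\: W) ballot_gain W x y A
    = D / 3%:R - 2%:R * \sum_(A : ballot C | x \in val A) P A / (utility A W)%:R.
  rewrite /D mulr_suml mulr_sumr.
  rewrite [X in _ = X - _]big_mkcond [X in _ = _ - X]big_mkcond -sumrB /=.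
  apply: eq_bigr => A _; rewrite sum_ballot_gain_in TW2.
  have [->|PA0] := eqVneq (P A) 0; first by rewrite !mul0r mulr0 !if_same subrr.
  have := tight_ballot PA0; rewrite utility_split.
  case: ifP => _ => [/and3P[/eqP a0 /eqP -> /eqP ->]|/andP[/eqP -> /eqP ->]].
    have xA : x \notin val A.
      apply: contra_eqN a0 => xA; rewrite -lt0n card_gt0.
      by apply/set0Pn; exists x; rewrite inE xA.
    by rewrite a0 (negbTE xA) /=; field.
  by rewrite addn0; case: (x \in _) => /=; rewrite ?subr0 ?mul0r ?mulr0; ring.
by rewrite tight_mass; lra.
Qed.

End Tight.
End Deviation.

(** * Existence of an optimum and stability after one swap *)

Lemma global_pav_exists (C : finType) (k : nat) (P : ballot C -> rat) :
  (k <= #|C|)%N -> exists W : {set C}, global_pav_committee k P W.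
Proof.
rewrite -bin_gt0 -card_draws card_gt0 => /set0Pn[W0]; rewrite inE => W0k.
have [W Wk maxW] := @arg_maxP _ _ _ W0 (is_committee k) (pav_score P) W0k.
by exists W.
Qed.

Lemma global_pav_swap (C : finType) (P : ballot C -> rat) (W T : {set C}) x y :
  is_profile P -> global_pav_committee 8 P W -> deviation 8 P W T ->
  x \in W :\: T -> y \in T :\: W ->
  global_pav_committee 8 P (y |: W :\ x).
Proof.
move=> hP hW hT xWT yTW; have := tight_swap hP hW hT xWT yTW.
move: xWT yTW; rewrite !inE => /andP[_ xW] /andP[yW _].
rewrite -pav_score_swap // => /eqP; rewrite subr_eq0 => /eqP eqW.
split; first by rewrite /is_committee card_swap //; exact: hW.1.
by rewrite eqW; exact: hW.2.
Qed.

Lemma swap_no_deviation (C : finType) (P : ballot C -> rat)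
    (W T T' : {set C}) (A : ballot C) x y :
  is_profile P -> global_pav_committee 8 P W -> deviation 8 P W T ->
  P A != 0 -> (utility A W < utility A T)%N ->
  x \in W :\: T -> y \in T :\: W -> y \in val A ->
  ~~ deviation 8 P (y |: W :\ x) T'.
Proof.
move=> hP hW hT PA0 devA xWT yTW yA; apply/negP => hT'.
have hW' := global_pav_swap hP hW hT xWT yTW.
have := xWT; rewrite !inE => /andP[xT xW].
have := yTW; rewrite !inE => /andP[yW yT].
have WT2 := (tight_card hP hW hT).2.
have sub_dev B : P B != 0 -> (utility B W < utility B T)%N ->
    [/\ utility B W = 2%N, W :&: T \subset val B & x \notin val B].
  move=> PB0 devB; have := tight_ballot hP hW hT PB0; rewrite devB.
  case/and3P => /eqP a0 /eqP b2 _; split.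
  - by rewrite (utility_split W T) a0 b2.
  - by apply/setIidPr/eqP; rewrite eqEcard subsetIr b2 WT2.
  - apply/negP => xB; move/eqP: a0; rewrite cards_eq0 => /eqP/setP/(_ x).
    by rewrite !inE xB xT xW.
have [z] : exists z, z \in W :&: T.
  by apply/set0Pn; rewrite -card_gt0 WT2.
move=> zWT; have := zWT; rewrite inE => /andP[zW zT].
have zW1 : z \in y |: W :\ x.
  by rewrite !inE zW andbT; apply/orP; right; apply: contraNneq xT => <-.
have [uA subA xA] := sub_dev A PA0 devA.
have uA' : utility A (y |: W :\ x) = 3%N.
  by have := utility_swap xW yW A; rewrite uA yA (negbTE xA) addn0.
(* If [A] preferred [T'], tightness would give it utility 2 in the new committee, not 3. So [A]
   approves nothing in the intersection of that committee with [T'], while it approves [z]. *)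
have zT' : z \notin T'.
  have := tight_ballot hP hW' hT' PA0; case: ifP => _.
    case/and3P => /eqP a0 /eqP b2 _.
    by move: uA'; rewrite (utility_split _ T') a0 b2.
  have zA : z \in val A by apply: (subsetP subA).
  case/andP; rewrite !cards_eq0 => /eqP/setP/(_ z) + _.
  by rewrite !in_setI zA zW1 in_set0 /= => ->.
have zW' : z \in (y |: W :\ x) :\: T' by rewrite in_setD zT'.
have := tight_loss hP hW' hT' zW'; apply/eqP; rewrite gt_eqF //.
(* Mass 1/2 at utility at most 3 gives a loss of at least 1/6, above 1/12. *)
apply: lt_le_trans (_ : 2%:R^-1 / 3%:R <= _); first by [].
rewrite -(tight_mass hP hW hT) mulr_suml.
rewrite big_mkcond [leRHS]big_mkcond; apply: ler_sum => B _ /=.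
have PB_ge0 : 0 <= P B by exact: hP.1.
have [->|PB0] := eqVneq (P B) 0; first by rewrite !mul0r !if_same.
case: ifP => devB; last by case: ifP => // _; rewrite divr_ge0 ?ler0n.
have [uB subB xB] := sub_dev B PB0 devB.
rewrite (subsetP subB _ zWT) ler_wpM2l //.
(* The utility of [B] after the swap is 3 or 2, according to whether [B] approves [y]. *)
have := utility_swap xW yW B; rewrite uB (negbTE xB) addn0 => ->.
by case: (y \in val B).
Qed.

End PAVSwaps.

Theorem theorem4p5 (C : finType) (P : ballot C -> rat)
  (hC : 8 <= #|C|) (hP : is_profile P) :
  exists W : {set C}, global_pav_committee 8 P W /\ W \in core 8 P.
Proof.
have [W hW] := global_pav_exists P hC.
have [coreW|] := boolP (W \in core 8 P); first by exists W.
have W8 : is_committee 8 W by exact: hW.1.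
rewrite inE /core_stable W8 negb_forall => /existsP[T]; rewrite negbK => hT.
have [A devA PA0] := dev_exists hT.
have [x xWT] : exists x, x \in W :\: T.
  apply/set0Pn; rewrite -card_gt0 cardsD (tight_card hP hW hT).2.
  by rewrite (eqP W8).
(* Taking [y] in the deviating ballot [A] raises its utility to 3 after the swap. *)
have [y] : exists y, y \in val A :&: (T :\: W).
  apply/set0Pn; rewrite -card_gt0.
  by move: devA; rewrite utility_dev; exact: leq_ltn_trans.
rewrite inE => /andP[yA yTW].
exists (y |: W :\ x); have hW' := global_pav_swap hP hW hT xWT yTW.
split=> //; rewrite inE /core_stable; apply/andP; split; first exact: hW'.1.
by apply/forallP => T'; exact: swap_no_deviation hT PA0 devA xWT yTW yA.
Qed.
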